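(* Let $(\Lambda_k)_{k\ge 0}$ be the Lidstone polynomials, i.e. the polynomials defined recursively by $\Lambda_0(x)=x$ and, for $k=1,2,\ldots$, $\Lambda_k''(x)=\Lambda_{k-1}(x)$ with $\Lambda_k(0)=\Lambda_k(1)=0$. Then for every integer $n\ge 1$, $$\zeta(2n)=\sum_{k=1}^{\infty}\frac{1}{k^{2n}}=(-1)^{n+1}\,\frac{\pi^{2n}\,\Lambda_n'(1)}{2},$$ where the numbers $\Lambda_n'(1)$ satisfy $\Lambda_0'(1)=1$ and, for every $n\ge 1$, $$\Lambda_n'(1)=\frac{1}{(2n)!}-\sum_{j=0}^{n-1}\frac{\Lambda_j'(1)}{(2n+1-2j)!}.$$
   Context: $\zeta$ denotes the Riemann zeta function. The Lidstone polynomials $\Lambda_k$ are real polynomials in one variable, uniquely determined by the recursion: $\Lambda_0(x)=x$, and for each $k\ge 1$, $\Lambda_k$ is the unique polynomial with $\Lambda_k''=\Lambda_{k-1}$ and $\Lambda_k(0)=\Lambda_k(1)=0$. Primes denote derivatives. *)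

(* Defs.v *)
From HB Require Import structures.
From mathcomp Require Import all_boot all_order all_algebra.
From mathcomp Require Import all_classical all_reals all_analysis.

Set Implicit Arguments.
Unset Strict Implicit.
Unset Printing Implicit Defensive.

Import Order.TTheory GRing.Theory Num.Theory.
Import numFieldNormedType.Exports.

Local Open Scope classical_set_scope.
Local Open Scope ring_scope.

(* The zeta function on the real half-line s > 1, where its Dirichlet series
   converges. For s <= 1 the value is meaningless: there is no continuation. *)
Definition zeta (R : realType) (s : R) : R :=
  limn [series (k.+1%:R : R) `^ (- s)]_k.

Definition lidstone (R : realType) (L : nat -> {poly R}) : Prop :=
  L 0%N = 'X /\
  forall k : nat, (1 <= k)%N ->
    [/\ (L k)^`(2) = L k.-1, (L k).[0] = 0 & (L k).[1] = 0].

Lemma lidstone_step (R : realType) (p : {poly R}) :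
  exists! q : {poly R}, [/\ q^`(2) = p, q.[0] = 0 & q.[1] = 0].
Proof.
pose I (r : {poly R}) : {poly R} := \poly_(i < (size r).+1) (r`_i.-1 / i%:R).
have dI r : (I r)^`() = r.
  apply/polyP => i; rewrite coef_deriv coef_poly ltnS /=.
  case: ltnP => [_|ri]; last by rewrite mul0rn nth_default.
  by rewrite -[LHS]mulr_natr mulfVK // pnatr_eq0.
have I0 r : (I r).[0] = 0 by rewrite horner_coef0 coef_poly /= invr0 mulr0.
set q' := I (I p) - (I (I p)).[1] *: 'X.
have q'2 : q'^`(2) = p.
  rewrite derivSn derivn1 /q' derivB derivZ derivB derivZ !dI derivX.
  by rewrite -polyC1 derivC scaler0 subr0.
have q'0 : q'.[0] = 0 by rewrite !hornerE I0 subrr.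
have q'1 : q'.[1] = 0 by rewrite !hornerE subrr.
exists q'; split=> // q [q2 q0 q1].
apply/eqP; rewrite -subr_eq0; apply/eqP; set d := q' - q.
have dE i : d`_i.+2 = 0.
  have : (d^`(2))`_i = 0 by rewrite derivnB q'2 q2 subrr coef0.
  rewrite coef_derivn addSn add1n => /eqP; rewrite mulrn_eq0.
  by rewrite -leqn0 leqNgt ffact_gt0 /= => /eqP.
have d0 : d`_0 = 0 by rewrite -horner_coef0 hornerD hornerN q'0 q0 subrr.
have {}dE : d = d`_1 *: 'X.
  apply/polyP => -[|[|i]]; rewrite coefZ coefX /= ?mulr0 ?mulr1 //.
have : d.[1] = 0 by rewrite hornerD hornerN q'1 q1 subrr.
by rewrite dE !hornerE => ->; rewrite scale0r.
Qed.

Lemma lidstone_exists_unique (R : realType) :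
  exists! L : nat -> {poly R}, lidstone L.
Proof.
have [next nextP] := choice (@lidstone_step R).
pose L := fix L k : {poly R} := if k is k'.+1 then next (L k') else 'X.
exists L; split=> [|M [M0 MS]].
  by split=> // -[//|k] _ /=; have [] := nextP (L k).
apply: funext => k; elim: k => [|k IH] /=; first by rewrite M0.
have [_ nextU] := nextP (L k); apply: nextU.
by rewrite IH; exact: (MS k.+1).
Qed.

(* Main.v *)
Require Import Defs.
From HB Require Import structures.
From mathcomp Require Import all_boot all_order all_algebra.
From mathcomp Require Import all_classical all_reals all_analysis.
From mathcomp Require Import zify ring lra.

(* Put P_n(x) = L_n(1 - x). Integrating by parts twice and inducting on n,
   int_0^1 P_n'(x) cos(k pi x) dx = (-1)^n / (k pi)^(2n) for k, n >= 1, and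
   int_0^1 P_n' = 0. Pairing P_n' with the Fejer kernel therefore yields, up to
   the factor 2 (-1)^n / pi^(2n), the Cesaro means of the partial sums of
   zeta(2n), while these pairings converge to P_n'(0) = - L_n'(1). Since the
   series converges, its Cesaro means converge to zeta(2n). The recursion for
   L_n'(1) is the Taylor expansion of L_n at 1, evaluated at 0. *)

Set Implicit Arguments.
Unset Strict Implicit.
Unset Printing Implicit Defensive.

Import Order.TTheory GRing.Theory Num.Theory.
Import numFieldNormedType.Exports.

Local Open Scope classical_set_scope.
Local Open Scope ring_scope.

(* Stands for [int_0^1 f = d]; a primitive suffices here, so that no measure
   theory is involved. *)
Definition increment01 (R : realType) (f : R -> R) (d : R) : Prop :=
  exists F : R -> R, (forall x, is_derive x (1 : R) F (f x)) /\ F 1 - F 0 = d.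

(** * Calculus of integrals over the unit interval through primitives *)

Section Increment.
Variable R : realType.
Implicit Types (f g : R -> R) (a c d : R).

Lemma increment01_ext f g d : f =1 g -> increment01 f d -> increment01 g d.
Proof. by move=> /funext ->. Qed.

Lemma increment01_cst a : increment01 (fun=> a) a.
Proof.
exists (a *: id); split; last by rewrite !fctE /GRing.scale /=; ring.
by move=> x; apply: is_derive_eq; rewrite /GRing.scale /= mulr1.
Qed.

Lemma increment01D f g c d : increment01 f c -> increment01 g d ->
  increment01 (fun x => f x + g x) (c + d).
Proof.
move=> [F [dF <-]] [G [dG <-]]; exists (F + G); split=> [x|].
  by have := dF x; have := dG x => *; apply: is_derive_eq.
by rewrite !fctE; ring.
Qed.

Lemma increment01Z a f d : increment01 f d ->
  increment01 (fun x => a * f x) (a * d).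
Proof.
move=> [F [dF <-]]; exists (a *: F); split=> [x|].
  by have := dF x => *; apply: is_derive_eq.
by rewrite !fctE /GRing.scale /=; ring.
Qed.

Lemma increment01B f g c d : increment01 f c -> increment01 g d ->
  increment01 (fun x => f x - g x) (c - d).
Proof.
move=> Hf /(increment01Z (-1)) /(increment01D Hf); rewrite mulN1r.
by apply: increment01_ext => x; rewrite mulN1r.
Qed.

Lemma increment01_sum n (f : nat -> R -> R) (d : nat -> R) :
  (forall i, increment01 (f i) (d i)) ->
  increment01 (fun x => \sum_(i < n) f i x) (\sum_(i < n) d i).
Proof.
move=> Hf; elim: n => [|n IH].
  rewrite big_ord0; apply: increment01_ext (increment01_cst 0) => x.
  by rewrite big_ord0.
rewrite big_ord_recr /=; apply: increment01_ext (increment01D IH (Hf n)) => x.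
by rewrite big_ord_recr.
Qed.

(** A primitive of [g - f] is nondecreasing. Asking for the inequality on the open interval only is
    what makes the positivity of the Fejer kernel usable, since it is obtained by dividing by
    [1 - cos (pi * x)], which is zero at 0. *)
Lemma ler_increment01 f g c d :
  (forall x, 0 < x < 1 -> f x <= g x) ->
  increment01 f c -> increment01 g d -> c <= d.
Proof.
move=> fg Hf Hg; rewrite -subr_ge0.
have [H [dH <-]] := increment01B Hg Hf; rewrite subr_ge0.
have dH1 x : derivable H x 1 by have [] := dH x.
apply: (@ger0_derive1_ndecr _ H 0 1) => // x.
  rewrite in_itv /= derive1E => /fg; rewrite -subr_ge0.
  by have -> := @derive_val _ _ _ _ _ _ _ (dH x).
by apply: derivable_within_continuous.
Qed.

Lemma increment01_poly (p : {poly R}) :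
  increment01 (fun x => p^`().[x]) (p.[1] - p.[0]).
Proof. by exists (horner p); split=> // x; apply: is_derive_poly. Qed.

Lemma is_derive_cosM a (x : R) :
  is_derive x (1 : R) (fun y => cos (a * y)) (- a * sin (a * x)).
Proof.
have da : is_derive x (1 : R) (a *: id) (a *: 1) by apply: is_deriveZ.
have df : is_derive ((a *: id) x) (1 : R) cos (- sin (a * x)) by apply: is_derive_cos.
by apply: is_derive_eq (is_derive1_comp df da) _; rewrite /GRing.scale /=; ring.
Qed.

Lemma is_derive_sinM a (x : R) :
  is_derive x (1 : R) (fun y => sin (a * y)) (a * cos (a * x)).
Proof.
have da : is_derive x (1 : R) (a *: id) (a *: 1) by apply: is_deriveZ.
have df : is_derive ((a *: id) x) (1 : R) sin (cos (a * x)) by apply: is_derive_sin.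
by apply: is_derive_eq (is_derive1_comp df da) _; rewrite /GRing.scale /=; ring.
Qed.

Lemma sin_natpi (k : nat) : sin (k%:R * pi : R) = 0.
Proof.
elim: k => [|k IH]; first by rewrite mul0r sin0.
by rewrite -natr1 mulrDl mul1r sinDpi IH oppr0.
Qed.

(* Two integrations by parts. *)
Lemma increment01_poly_cos (p : {poly R}) (k : nat) d : (0 < k)%N ->
  increment01 (fun x => p^`(3).[x] * cos (k%:R * pi * x)) d ->
  increment01 (fun x => p^`().[x] * cos (k%:R * pi * x))
    ((p^`(2).[1] * cos (k%:R * pi) - p^`(2).[0] - d) / (k%:R * pi) ^+ 2).
Proof.
move=> k0; set a : R := k%:R * pi => -[F [dF Fd]].
have a0 : a != 0 by rewrite mulf_neq0 ?pnatr_eq0 -?lt0n ?gt_eqF ?pi_gt0.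
exists (fun x => (p^`().[x] * sin (a * x)) / a +
   (p^`(2).[x] * cos (a * x) - F x) / a ^+ 2); split; last first.
  rewrite !mulr1 !mulr0 sin_natpi sin0 cos0 -Fd -/a; field; exact: a0.
move=> x.
have D1 : is_derive x (1 : R) (horner p^`()) p^`(2).[x].
  by have := is_derive_poly p^`() x.
have D2 : is_derive x (1 : R) (horner p^`(2)) p^`(3).[x].
  by have := is_derive_poly p^`(2) x.
have Dc := is_derive_cosM a x.
have Ds := is_derive_sinM a x.
have Df := dF x.
pose s y := sin (a * y); pose c y := cos (a * y).
have : is_derive x (1 : R) (a^-1 *: (horner p^`() * s) +
   (a ^- 2) *: (horner p^`(2) * c - F)) (p^`().[x] * cos (a * x)).
  apply: is_derive_eq; rewrite /s /c /GRing.scale /=; field; exact: a0.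
congr (is_derive _ _ _ _).
by apply: funext => y; rewrite !fctE /GRing.scale /= -/(s y) -/(c y); ring.
Qed.

Lemma increment01_cos (k : nat) : (0 < k)%N ->
  increment01 (fun x : R => cos (k%:R * pi * x)) 0.
Proof.
move=> k0; set a : R := k%:R * pi.
have a0 : a != 0 by rewrite mulf_neq0 ?pnatr_eq0 -?lt0n ?gt_eqF ?pi_gt0.
exists (a^-1 *: (fun y => sin (a * y))); split=> [x|]; last first.
  by rewrite !fctE mulr1 mulr0 sin_natpi sin0 scaler0 subrr.
have Ds := is_derive_sinM a x.
by apply: is_derive_eq; rewrite /GRing.scale /= mulKf.
Qed.

End Increment.

(** * Dirichlet and Fejer kernels, and concentration of the latter at 0 *)

Section Fejer.
Variable R : realType.
Implicit Types t : R.

Definition dirichlet_kernel (m : nat) t : R :=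
  1 + \sum_(k < m) 2 * cos (k.+1%:R * t).

(* The customary Fejer kernel is this sum divided by [N]. *)
Definition fejer_sum (N : nat) t : R := \sum_(m < N) dirichlet_kernel m t.

(** By the addition formulas, [(1 - cos t) * 2 cos (k t)] is minus the second difference of
    [cos (k t)] in [k], so the sum telescopes. Multiplying by [1 - cos t] instead of dividing keeps
    the identity valid at [t = 0]. *)
Lemma dirichlet_kernelE m t :
  (1 - cos t) * dirichlet_kernel m t = cos (m%:R * t) - cos (m.+1%:R * t).
Proof.
rewrite /dirichlet_kernel; elim: m => [|m IH].
  by rewrite big_ord0 addr0 mulr1 mul0r mul1r cos0.
rewrite big_ord_recr /= addrA mulrDr {}IH.
have -> : m.+2%:R * t = m.+1%:R * t + t by rewrite -[m.+2%:R]natr1; ring.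
have -> : m%:R * t = m.+1%:R * t - t by rewrite -[m.+1%:R]natr1; ring.
rewrite cosB cosD; ring.
Qed.

(** A second telescoping; this closed form yields both the positivity of the kernel and its bound
    away from 0. *)
Lemma fejer_sumE N t : (1 - cos t) * fejer_sum N t = 1 - cos (N%:R * t).
Proof.
rewrite /fejer_sum; elim: N => [|N IH].
  by rewrite big_ord0 mulr0 mul0r cos0 subrr.
by rewrite big_ord_recr /= mulrDr IH dirichlet_kernelE; ring.
Qed.

Lemma cos_pi_lt1 (x y : R) : 0 <= x -> x < y -> y <= 1 ->
  cos (pi * y) < cos (pi * x).
Proof.
have p0 := pi_gt0 R.
have inpi (z : R) : 0 <= z -> z <= 1 -> pi * z \in `[0, pi].
  by move=> z0 z1; rewrite in_itv /= mulr_ge0 ?ler_piMr // ltW.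
move=> x0 xy y1; have x1 := le_trans (ltW xy) y1.
by rewrite ltr_cos ?ltr_pM2l ?inpi // (le_trans x0) // ltW.
Qed.

Lemma fejer_sum_ge0 N (x : R) : 0 < x < 1 -> 0 <= fejer_sum N (pi * x).
Proof.
move=> /andP[x0 x1].
have := cos_pi_lt1 (lexx 0) x0 (ltW x1); rewrite mulr0 cos0 => c1.
rewrite -(@pmulr_rge0 _ (1 - cos (pi * x))) ?subr_gt0 // fejer_sumE subr_ge0.
exact: cos_le1.
Qed.

(** All cosines integrate to 0, so each of the [N] Dirichlet kernels contributes only its constant
    term 1. *)
Lemma increment01_fejer_sum N :
  increment01 (fun x => fejer_sum N (pi * x)) N%:R.
Proof.
have H k := @increment01_cos R k.+1 isT.
have := @increment01_sum R N (fun m x => dirichlet_kernel m (pi * x)) (fun=> 1).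
rewrite sumr_const card_ord; apply=> m.
have := @increment01_sum R m (fun k x => 2 * cos (k.+1%:R * pi * x)) (fun=> 2 * 0).
rewrite (eq_bigr (fun=> 0)) ?big1 // => [|i _]; last by rewrite mulr0.
move=> /(_ (fun k => increment01Z 2 (H k))) /(increment01D (increment01_cst 1)).
rewrite addr0; apply: increment01_ext => x.
by congr (_ + _); apply: eq_bigr => k _; rewrite mulrA.
Qed.

(** Near 0, continuity gives the bound [e]; elsewhere [g] is bounded and [1 - cos (pi * x)] stays
    away from 0. The error is measured by [1 - cos (pi * x)] because this factor turns [fejer_sum]
    into a bounded function. *)
Lemma continuous_bound_cos (g : R -> R) (e : R) : continuous g -> g 0 = 0 -> 0 < e ->
  exists2 C, 0 <= C & forall x, 0 <= x <= 1 -> `|g x| <= e + C * (1 - cos (pi * x)).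
Proof.
move=> cg g0 e0.
have /cvgrPdist_lt/(_ e e0)[/= r r0 gr] := cg 0.
have [M _ gM] : exists2 c : R, c \in `[0, 1] &
    forall t, t \in `[0, 1] -> `|g t| <= `|g c|.
  apply: (@EVT_max R (fun x => `|g x|)) => //.
  apply: continuous_subspaceT => x; apply: continuous_comp; first exact: cg.
  exact: norm_continuous.
pose d := Num.min r 1 / 2.
have d0 : 0 < d by rewrite divr_gt0 // lt_min r0 ltr01.
have dr : d < r by rewrite /d; case: (leP r 1) => *; lra.
have d1 : d <= 1 by rewrite /d; case: (leP r 1) => *; lra.
have := cos_pi_lt1 (lexx 0) d0 d1; rewrite mulr0 cos0 -subr_gt0 => cd.
(* The maximum of [|g|] over the least value of [1 - cos (pi * x)] on [[d, 1]]. *)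
exists (`|g M| / (1 - cos (pi * d))) => [|x /andP[x0 x1]].
  by rewrite divr_ge0 // ltW.
have [xd|dx] := ltP x d.
  rewrite -[leLHS]addr0 lerD //.
    have := gr x; rewrite /= g0 !sub0r !normrN => H; apply/ltW/H.
    by rewrite ger0_norm // (lt_trans xd).
rewrite -[leLHS]add0r lerD ?(ltW e0) //.
apply: (le_trans (gM x _)); first by rewrite in_itv /= x0.
rewrite mulrAC ler_pdivlMr // ler_wpM2l // lerD2l lerN2.
by move: dx; rewrite le_eqVlt => /predU1P[->//|dx]; exact/ltW/cos_pi_lt1/x1/dx/ltW.
Qed.

(** Since [C] does not depend on [N], dividing by [N] shows that the pairing of [g] with the
    normalized kernel tends to [g 0 = 0]. *)
Lemma fejer_sum_bound (g : R -> R) (e : R) : continuous g -> g 0 = 0 -> 0 < e ->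
  exists C, forall N d, increment01 (fun x => g x * fejer_sum N (pi * x)) d ->
    `|d| <= e * N%:R + C.
Proof.
move=> cg g0 e0; have [C C0 gC] := continuous_bound_cos cg g0 e0.
exists (C * 2) => N d Hd.
have B x : 0 < x < 1 ->
    `|g x * fejer_sum N (pi * x)| <= e * fejer_sum N (pi * x) + C * 2.
  move=> /[dup] /(fejer_sum_ge0 N) F0 /andP[x0 x1].
  rewrite normrM (ger0_norm F0).
  have x01 : 0 <= x <= 1 by rewrite !ltW.
  rewrite (le_trans (ler_wpM2r F0 (gC x x01))) // mulrDl lerD2l -mulrA ler_wpM2l // fejer_sumE.
  by have := cos_geN1 (N%:R * (pi * x)); lra.
have Hb := increment01D (increment01Z e (increment01_fejer_sum N))
  (increment01_cst (C * 2)).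
rewrite ler_norml; apply/andP; split; last first.
  by apply: ler_increment01 Hd Hb => x /B; rewrite ler_norml => /andP[].
have := increment01Z (-1) Hb; rewrite mulN1r => Hb'.
apply: ler_increment01 Hb' Hd => x /B; rewrite ler_norml => /andP[].
by rewrite mulN1r.
Qed.

End Fejer.

(** * Derivatives of Lidstone polynomials and the recursion at 1 *)

Section Lidstone.
Variables (R : realType) (L : nat -> {poly R}).
Hypothesis hL : lidstone L.

Lemma lidstone0 : L 0 = 'X. Proof. by case: hL. Qed.

Lemma lidstoneS n : [/\ (L n.+1)^`(2) = L n, (L n.+1).[0] = 0 & (L n.+1).[1] = 0].
Proof. by case: hL => _ /(_ n.+1 isT). Qed.

Lemma derivn_lidstone i n : (L (i + n))^`(i.*2) = L n.
Proof.
elim: i => [|i IH]; first by rewrite derivn0.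
have [h _ _] := lidstoneS (i + n).
by rewrite addSn doubleS !derivSn -derivn1 -derivSn h.
Qed.

(** The derivative of order [2n] is ['X], so the one of order [2n + 2] vanishes. This tells where
    the Taylor expansion stops. *)
Lemma size_lidstone n : (size (L n) <= n.+1.*2)%N.
Proof.
apply/leq_sizeP => j jn.
have : (L n)^`(n.+1.*2)`_(j - n.+1.*2) = 0.
  have h := derivn_lidstone n 0; rewrite addn0 in h.
  by rewrite doubleS !derivnS h lidstone0 derivX -polyC1 derivC coef0.
rewrite coef_derivn subnKC // => /eqP.
by rewrite mulrn_eq0 -leqn0 leqNgt ffact_gt0 jn => /eqP.
Qed.

Lemma lidstone_deriv0 : (L 0)^`().[1] = 1.
Proof. by rewrite lidstone0 derivX hornerC. Qed.

(* Taylor expansion of [L n] at 1, evaluated at 0: the even-order terms are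
   values at 1, which vanish except for the top one. *)
Lemma lidstone_deriv_sum n : (0 < n)%N ->
  \sum_(0 <= j < n.+1) (L j)^`().[1] / ((2 * n + 1 - 2 * j)`!)%:R
    = ((2 * n)`!)%:R^-1.
Proof.
move=> n0.
have nd i : (L n)^`N(i).[1] = (L n)^`(i).[1] / i`!%:R.
  by rewrite nderivn_def hornerMn -[X in X / _]mulr_natr mulfK //.
have : (L n).[1 + (-1)] = 0.
  by case: n n0 {nd} => // n _; rewrite subrr; case: (lidstoneS n).
rewrite (nderiv_taylor_wide (mulrC _ _) (size_lidstone n)).
rewrite (eq_bigr (fun i : 'I__ => (L n)^`(i).[1] / i`!%:R * (-1) ^+ i)); last first.
  by move=> i _; rewrite nd.
rewrite -(big_mkord xpredT (fun i => (L n)^`(i).[1] / i`!%:R * (-1) ^+ i)).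
have -> (f : nat -> R) N : \sum_(0 <= i < N.*2) f i =
    \sum_(0 <= i < N) (f i.*2 + f i.*2.+1).
  elim: N => [|N IH]; first by rewrite !big_geq.
  by rewrite doubleS !big_nat_recr //= IH addrA.
rewrite big_split /= big_nat_recr //= big_nat big1 => [|i /andP[_ ilt]]; last first.
  have -> : n = (i + (n - i.+1).+1)%N by lia.
  by rewrite derivn_lidstone; have [_ _ ->] := lidstoneS (n - i.+1); rewrite !mul0r.
have := derivn_lidstone n 0; rewrite addn0 => ->; rewrite lidstone0 hornerX.
rewrite -signr_odd odd_double expr0 mulr1 add0r mul1r => /eqP.
rewrite addr_eq0 -mul2n => /eqP ->.
(* With [j = n - i], the derivative of [L n] of order [2i + 1] is that of [L j] of order 1; the odd
   power of -1 absorbs the minus sign. *)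
rewrite -sumrN big_nat_rev big_nat [in RHS]big_nat /=.
apply: eq_bigr => i /= ilt.
have -> : (2 * n + 1 - 2 * (0 + n.+1 - i.+1))%N = i.*2.+1 by lia.
rewrite add0n subSS.
have := derivn_lidstone i (n - i); rewrite subnKC // => ->.
rewrite exprS -signr_odd odd_double; ring.
Qed.

(** The term [j = n] of the preceding sum has denominator [1!] and can be isolated. *)
Lemma lidstone_deriv_rec n : (0 < n)%N ->
  (L n)^`().[1] = ((2 * n)`!)%:R^-1
    - \sum_(0 <= j < n) (L j)^`().[1] / ((2 * n + 1 - 2 * j)`!)%:R.
Proof.
move=> /lidstone_deriv_sum <-; rewrite big_nat_recr //=.
by rewrite addKn divr1 addrAC subrr add0r.
Qed.

(** * Cosine coefficients of the reflected Lidstone polynomials *)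

Let P n := L n \Po (1 - 'X).

(** Reflection brings the endpoint 1 to 0, where the Fejer kernel concentrates, and preserves the
    recursion because two derivatives cancel the sign. *)
Let PS n : [/\ (P n.+1)^`(2) = P n, (P n.+1).[0] = 0 & (P n.+1).[1] = 0].
Proof.
have [h h0 h1] := lidstoneS n.
have dq : (1 - 'X : {poly R})^`() = -1.
  by rewrite derivB derivX -polyC1 derivC sub0r.
split; last 2 first.
- by rewrite horner_comp !hornerE subr0 h1.
- by rewrite horner_comp !hornerE subrr h0.
rewrite derivSn derivn1 !deriv_comp dq mulrN1 derivN deriv_comp dq mulrN1 opprK.
by rewrite /P -h derivSn derivn1.
Qed.

Let P0 : P 0 = 1 - 'X. Proof. by rewrite /P lidstone0 comp_polyX. Qed.

Let dP0 n : (P n)^`().[0] = - (L n)^`().[1].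
Proof.
rewrite deriv_comp derivB derivX -polyC1 derivC sub0r !hornerE horner_comp.
by rewrite !hornerE subr0 mulrN1.
Qed.

Let increment01_lidstone_cos n k : (0 < k)%N ->
  increment01 (fun x => (P n.+1)^`().[x] * cos (k%:R * pi * x))
    ((-1) ^+ n.+1 / (k%:R * pi) ^+ (2 * n.+1)).
Proof.
move=> k0; have a0 : k%:R * pi != 0 :> R.
  by rewrite mulf_neq0 ?pnatr_eq0 -?lt0n ?gt_eqF ?pi_gt0.
elim: n => [|n IH].
  (* Only here is a boundary term nonzero: [P 0] takes the value 1 at 0. Each later step just
     multiplies by [- 1 / (k pi)^2]. *)
  have [h _ _] := PS 0.
  have : increment01 (fun x => (P 1)^`(3).[x] * cos (k%:R * pi * x)) 0.
    have := increment01Z (-1) (@increment01_cos R k k0); rewrite mulr0.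
    apply: increment01_ext => x.
    by rewrite derivnS h P0 derivB derivX -polyC1 derivC sub0r !hornerE; ring.
  move=> /(increment01_poly_cos k0); rewrite h P0 !hornerE.
  rewrite subrr mul0r; congr (increment01 _ _).
  by move: (k%:R * pi) a0 => a a0; field.
have [h _ _] := PS n.+1; have [_ h0 h1] := PS n.
have : increment01 (fun x => (P n.+2)^`(3).[x] * cos (k%:R * pi * x))
    ((-1) ^+ n.+1 / (k%:R * pi) ^+ (2 * n.+1)).
  by apply: increment01_ext IH => x; rewrite derivnS h.
move=> /(increment01_poly_cos k0); rewrite h h0 h1.
congr (increment01 _ _).
rewrite (exprS _ n.+1) (mulnS 2 n.+1) exprD.
by move: (k%:R * pi) a0 => a a0; field; rewrite a0 expf_neq0.
Qed.

Let s n : R ^nat := series (fun k => ((k.+1%:R : R) ^+ (2 * n))^-1).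

(** Here [s n.+1] is already a sequence of partial sums, so [series (s n.+1) N] is the numerator of
    a Cesaro mean. Its entry of index [m] has [m] terms, one for each cosine of
    [dirichlet_kernel m]. *)
Let increment01_lidstone_fejer n N :
  increment01 (fun x => ((P n.+1)^`().[x] - (P n.+1)^`().[0]) * fejer_sum N (pi * x))
   (2 * (-1) ^+ n.+1 / pi ^+ (2 * n.+1) * series (s n.+1) N
     + N%:R * (L n.+1)^`().[1]).
Proof.
have [_ h0 h1] := PS n.
have HP : increment01 (fun x => (P n.+1)^`().[x]) 0.
  by have := increment01_poly (P n.+1); rewrite h0 h1 subrr.
have HA := increment01_lidstone_cos n.
pose c k : R := 2 * ((-1) ^+ n.+1 / (k.+1%:R * pi) ^+ (2 * n.+1)).
have Hd m : increment01 (fun x => (P n.+1)^`().[x] * dirichlet_kernel m (pi * x))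
    (\sum_(k < m) c k).
  have := @increment01_sum R m
    (fun k x => 2 * ((P n.+1)^`().[x] * cos (k.+1%:R * pi * x))) c.
  move=> /(_ (fun k => increment01Z 2 (HA k.+1 isT))) /(increment01D HP).
  rewrite add0r; apply: increment01_ext => x.
  rewrite /dirichlet_kernel mulrDr mulr1; congr (_ + _).
  by rewrite mulr_sumr; apply: eq_bigr => k _; rewrite mulrCA !mulrA.
have := @increment01_sum R N
  (fun m x => (P n.+1)^`().[x] * dirichlet_kernel m (pi * x)) _ Hd.
move=> /increment01B /(_ (increment01Z (P n.+1)^`().[0] (increment01_fejer_sum R N))).
rewrite dP0 mulNr opprK [_ * N%:R]mulrC.
rewrite /s /series /= big_mkord mulr_sumr => H.
suff -> : \sum_(i < N) 2 * (-1) ^+ n.+1 / pi ^+ (2 * n.+1) *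
     (\sum_(0 <= k < i) ((k.+1%:R : R) ^+ (2 * n.+1))^-1) =
     \sum_(i < N) \sum_(k < i) c k.
  apply: increment01_ext H => x.
  by rewrite mulrBl; congr (_ - _); rewrite /fejer_sum mulr_sumr.
apply: eq_bigr => i _; rewrite big_mkord mulr_sumr; apply: eq_bigr => k _.
by rewrite /c exprMn invfM; ring.
Qed.

(** * Convergence of the series and identification of its sum *)

Lemma is_cvg_zeta_even n : cvgn [series ((k.+1%:R : R) ^+ (2 * n.+1))^-1]_k.
Proof.
apply: nondecreasing_is_cvgn.
  apply: nondecreasing_series => i _ _.
  by rewrite invr_ge0 exprn_ge0.
exists 2 => _ [m _ <-] /=.
(* This sharper bound is inductive, by comparison with the telescoping [1 / (m (m + 1))]. *)
suff H : series (fun k => ((k.+1%:R : R) ^+ (2 * n.+1))^-1) m.+1 <= 2 - m.+1%:R^-1.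
  apply: le_trans (le_trans H _); last by rewrite gerBl.
  by rewrite seriesSr lerDl invr_ge0 exprn_ge0.
elim: m => [|m IH].
  by rewrite /series /= big_nat1 expr1n !invr1; lra.
rewrite /series /= big_nat_recr //=.
apply: (le_trans (lerD IH (lexx _))).
have m1 : 0 < m.+1%:R :> R by rewrite ltr0n.
have : (m.+2%:R ^+ (2 * n.+1))^-1 <= (m.+2%:R * m.+1%:R)^-1 :> R.
  rewrite lef_pV2 ?posrE ?mulr_gt0 ?exprn_gt0 // mulnS exprD expr2 -mulrA.
  rewrite ler_wpM2l // (@le_trans _ _ m.+2%:R) ?ler_nat // ler_peMr //.
  by rewrite exprn_ege1 // ler1n.
suff -> : (m.+2%:R * m.+1%:R)^-1 = m.+1%:R^-1 - m.+2%:R^-1 :> R.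
  by move=> h; apply: le_trans (lerD (lexx _) h) _; rewrite addrA subrK.
by rewrite -[m.+2%:R]natr1; field; rewrite !lt0r_neq0 //; lra.
Qed.

Lemma lim_zeta_even n : limn [series ((k.+1%:R : R) ^+ (2 * n.+1))^-1]_k =
  (-1) ^+ n.+2 * (pi ^+ (2 * n.+1) * (L n.+1)^`().[1] / 2).
Proof.
set S := limn _; pose K : R := 2 * (-1) ^+ n.+1 / pi ^+ (2 * n.+1).
have pin0 : pi ^+ (2 * n.+1) != 0 :> R by rewrite expf_neq0 // gt_eqF ?pi_gt0.
(* The left side is the limit of the normalized pairings of [P' - P'(0)] with the Fejer kernel,
   where [P] is [P n.+1]. *)
suff : K * S + (L n.+1)^`().[1] = 0.
  move=> /eqP; rewrite addrC addr_eq0 => /eqP ->; rewrite /K.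
  suff : (-1) ^+ n.+1 * (-1) ^+ n.+1 = 1 :> R by rewrite (exprS _ n.+1) => H; field: H.
  by rewrite -expr2 sqrr_sign.
have mS := cesaro (@is_cvg_zeta_even n : s n.+1 @ \oo --> S).
have mK : `|K * arithmetic_mean (s n.+1) m + (L n.+1)^`().[1]| @[m --> \oo] -->
    `|K * S + (L n.+1)^`().[1]|.
  by apply: cvg_norm; apply: cvgD; [exact: cvgM (cvg_cst _) mS|exact: cvg_cst].
apply/normr0_eq0/eqP; rewrite eq_le normr_ge0 andbT.
apply/ler_addgt0Pr => e e0; rewrite add0r.
pose g x := (P n.+1)^`().[x] - (P n.+1)^`().[0].
have cg : continuous g.
  by move=> x; apply: cvgB; [exact: continuous_horner|exact: cvg_cst].
have [C HC] := fejer_sum_bound cg (subrr _) e0.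
have eC : e + C * harmonic m @[m --> \oo] --> e + C * 0.
  by apply: cvgD; [exact: cvg_cst|exact: cvgM (cvg_cst _) cvg_harmonic].
rewrite mulr0 addr0 in eC.
apply: ler_cvg_to mK eC _; near=> m.
have m0 : 0 < m.+1%:R :> R by rewrite ltr0n.
(* [arithmetic_mean] at [m] averages [m + 1] entries, hence the kernel with [N = m.+1]. *)
have -> : K * arithmetic_mean (s n.+1) m + (L n.+1)^`().[1] =
    (K * series (s n.+1) m.+1 + m.+1%:R * (L n.+1)^`().[1]) / m.+1%:R.
  by rewrite /arithmetic_mean /=; field; rewrite lt0r_neq0.
rewrite normrM normfV (gtr0_norm m0) ler_pdivrMr // mulrDl /harmonic /=.
by rewrite divfK ?lt0r_neq0 //; apply: HC; exact: increment01_lidstone_fejer.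
Unshelve. all: by end_near.
Qed.

End Lidstone.

Theorem mainTheorem1 (R : realType) (L : nat -> {poly R}) (hL : lidstone L) :
  (forall n : nat, (1 <= n)%N ->
     [/\ cvgn [series ((k.+1%:R : R) ^+ (2 * n))^-1]_k,
         zeta ((2 * n)%:R : R) = limn [series ((k.+1%:R : R) ^+ (2 * n))^-1]_k &
         zeta ((2 * n)%:R : R) =
           (-1) ^+ n.+1 * (pi ^+ (2 * n) * (L n)^`().[1] / 2)])
  /\ (L 0%N)^`().[1] = 1
  /\ (forall n : nat, (1 <= n)%N ->
        (L n)^`().[1] =
          ((2 * n)`!)%:R^-1
          - \sum_(0 <= j < n) (L j)^`().[1] / ((2 * n + 1 - 2 * j)`!)%:R).
Proof.
split; last by split; [exact: lidstone_deriv0|exact: lidstone_deriv_rec].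
case=> // n _.
have zE : zeta ((2 * n.+1)%:R : R) =
    limn [series ((k.+1%:R : R) ^+ (2 * n.+1))^-1]_k.
  (* Termwise, the real power with a negated natural exponent is the inverse of the natural
     power. *)
  congr (limn (series _)); apply: funext => k.
  exact: powR_invn.
split; [exact: is_cvg_zeta_even|exact: zE|].
by rewrite zE; exact: lim_zeta_even.
Qed.
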